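(* If $\Gamma$ is an infinite finitely generated linear group over $\mathbf{C}$ (an infinite finitely generated subgroup of $\mathrm{GL}(m,\mathbf{C})$ for some $m$), then the normal residual average $\mathrm{Ave}^{\lhd}(\Gamma)$ is finite.
   Context: Let $\Gamma$ be an infinite, finitely generated, residually finite group (finitely generated linear groups are residually finite). Let $\widehat{\Gamma}$ be its profinite completion, $\mu$ the Haar probability measure on $\widehat{\Gamma}$, and for a finite index subgroup $\Delta\le\Gamma$ let $\overline{\Delta}$ be the closure of (the image of) $\Delta$ in $\widehat\Gamma$. The normal divisibility function $D^{\lhd}_\Gamma:\Gamma\smallsetminus\{1\}\to\mathbf{N}$ is \[ D^{\lhd}_\Gamma(\gamma)=\min\{[\Gamma:\Delta] : \Delta\lhd\Gamma \text{ a normal finite index subgroup},\ \gamma\notin\Delta\}. \] Setting $D^{\lhd}_\Gamma(1)=\infty$, it extends uniquely to a continuous function $D^{\lhd}_{\widehat\Gamma}:\widehat\Gamma\to\mathbf{N}\cup\{\infty\}$, given by $D^{\lhd}_{\widehat\Gamma}(x)=\min\{[\Gamma:\Delta] : \Delta\lhd\Gamma\text{ normal of finite index},\ x\notin\overline{\Delta}\}$ (with $\min\emptyset=\infty$). The normal residual average is $\mathrm{Ave}^{\lhd}(\Gamma)=\int_{\widehat\Gamma}D^{\lhd}_{\widehat\Gamma}\,d\mu\in[0,\infty]$. *)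

(* Defs.v *)
From HB Require Import structures.
From mathcomp Require Import all_boot all_order all_algebra complex.
From mathcomp Require Import finmap.
From mathcomp Require Import all_classical all_reals all_analysis.

Set Implicit Arguments.
Unset Strict Implicit.
Unset Printing Implicit Defensive.

Import Order.TTheory GRing.Theory Num.Theory.
Import numFieldNormedType.Exports.

Local Open Scope classical_set_scope.
Local Open Scope group_scope.

Section Groups.
Context {G : groupType}.
Implicit Types H : set G.

Definition subgroup H : Prop :=
  [/\ H 1, forall x y, H x -> H y -> H (x * y) & forall x, H x -> H x^-1].

Definition normal_subgroup H : Prop :=
  subgroup H /\ forall g h, H h -> H (h ^ g).

Definition left_coset (g : G) H : set G := [set g * h | h in H].

Definition left_cosets H : set (set G) := [set left_coset g H | g in [set: G]].

Definition finite_index H : Prop := finite_set (left_cosets H).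

(* Meaningful only under [finite_index H]: [fset_set] of an infinite set is
   empty. *)
Definition subgroup_index H : nat := #|` fset_set (left_cosets H)|.

End Groups.

Definition finitely_generated (G : groupType) : Prop :=
  exists s : seq G,
    forall H : set G, subgroup H -> [set` s] `<=` H -> H = [set: G].

Definition linear_group (K : fieldType) (G : groupType) : Prop :=
  exists (m : nat) (rho : G -> 'M[K]_m),
    [/\ injective rho, forall g, rho g \in unitmx, rho 1 = (1%:M)%R
      & {morph rho : x y / x * y >-> (x *m y)%R}].

Record nfi (G : groupType) := NFI {
  nfi_set :> set G;
  nfi_normal : normal_subgroup nfi_set;
  nfi_finite : finite_index nfi_set
}.

(* The inverse limit of the finite quotients G/N, N normal of finite index:
   a point is a family of cosets x N of N such that, whenever N is contained
   in M, the map G/N -> G/M sends x N to x M. *)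
Record profinite (G : groupType) := Profinite {
  pf_proj :> nfi G -> set G;
  pf_coset : forall N : nfi G, left_cosets N (pf_proj N);
  pf_compat : forall N M : nfi G, N `<=` M -> pf_proj N `<=` pf_proj M
}.

HB.instance Definition _ (G : groupType) := gen_eqMixin (profinite G).
HB.instance Definition _ (G : groupType) := gen_choiceMixin (profinite G).

Section ProfiniteGroup.
Context {G : groupType}.
Implicit Types (N M : nfi G) (x y z : profinite G).

Lemma pf_ext x y : (forall N, x N = y N) -> x = y.
Proof.
case: x y => [x xc xm] [y yc ym] /= /funext e; case: y / e yc ym => yc ym.
by congr Profinite; exact: Prop_irrelevance.
Qed.

Lemma nfi1 N : nfi_set N 1. Proof. by have [[]] := nfi_normal N. Qed.

Lemma nfiM N g h : nfi_set N g -> nfi_set N h -> nfi_set N (g * h).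
Proof. by have [[_ + _] _] := nfi_normal N; apply. Qed.

Lemma nfiV N g : nfi_set N g -> nfi_set N g^-1.
Proof. by have [[_ _ +] _] := nfi_normal N; apply. Qed.

Lemma nfiJ N g h : nfi_set N h -> nfi_set N (h ^ g).
Proof. by have [_ +] := nfi_normal N; apply. Qed.

Lemma left_coset_mul N g h :
  [set a * b | a in left_coset g N & b in left_coset h N]
    = left_coset (g * h) N.
Proof.
apply/seteqP; split => [_ [_ [a Na <-] [_ [b Nb <-] <-]]|_ [a Na <-]].
  exists (a ^ h * b); first by apply: nfiM => //; exact: nfiJ.
  by rewrite conjgE !mulgA mulgK.
exists g; first by exists 1; [exact: nfi1|rewrite mulg1].
by exists (h * a); [exists a|rewrite mulgA].
Qed.

Lemma left_coset_inv N g :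
  [set a^-1 | a in left_coset g N] = left_coset g^-1 N.
Proof.
apply/seteqP; split => [_ [_ [a Na <-] <-]|_ [a Na <-]].
  exists (a^-1 ^ g^-1); first by apply: nfiJ; exact: nfiV.
  by rewrite conjgE invgK invgM !mulgA mulVg mul1g.
exists (g * (a ^ g)^-1); last by rewrite invgM invgK conjgE !mulgA mulgK.
by exists (a ^ g)^-1 => //; apply: nfiV; exact: nfiJ.
Qed.

Lemma left_coset_sub N M g : N `<=` M -> left_coset g N `<=` left_coset g M.
Proof. by move=> NM _ [a Na <-]; exists a => //; exact: NM. Qed.

Lemma pf_embed_coset g N : left_cosets N (left_coset g N).
Proof. by exists g. Qed.

Definition pf_embed (g : G) : profinite G :=
  @Profinite G (fun N => left_coset g N) (pf_embed_coset g)
    (fun N M => @left_coset_sub N M g).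

Lemma pf_mul_coset x y N : left_cosets N [set a * b | a in x N & b in y N].
Proof.
have [[g _ <-] [h _ <-]] := (pf_coset x N, pf_coset y N).
by rewrite left_coset_mul; exists (g * h).
Qed.

Lemma pf_mul_compat x y N M : N `<=` M ->
  [set a * b | a in x N & b in y N] `<=` [set a * b | a in x M & b in y M].
Proof.
move=> NM _ [a xa [b yb <-]].
by exists a; [exact: (pf_compat NM xa)|exists b => //; exact: (pf_compat NM yb)].
Qed.

Definition pf_mul x y : profinite G :=
  Profinite (pf_mul_coset x y) (@pf_mul_compat x y).

Lemma pf_inv_coset x N : left_cosets N [set a^-1 | a in x N].
Proof.
by have [g _ <-] := pf_coset x N; rewrite left_coset_inv; exists g^-1.
Qed.

Lemma pf_inv_compat x N M : N `<=` M ->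
  [set a^-1 | a in x N] `<=` [set a^-1 | a in x M].
Proof. by move=> NM _ [a xa <-]; exists a => //; exact: (pf_compat NM xa). Qed.

Definition pf_inv x : profinite G :=
  Profinite (pf_inv_coset x) (@pf_inv_compat x).

Lemma pf_mulA : associative pf_mul.
Proof.
move=> x y z; apply: pf_ext => N /=.
have [[g _ <-] [h _ <-] [k _ <-]] :=
  And3 (pf_coset x N) (pf_coset y N) (pf_coset z N).
by rewrite !left_coset_mul mulgA.
Qed.

Lemma pf_mul1 : left_id (pf_embed 1) pf_mul.
Proof.
move=> x; apply: pf_ext => N /=.
by have [g _ <-] := pf_coset x N; rewrite left_coset_mul mul1g.
Qed.

Lemma pf_mulr1 : right_id (pf_embed 1) pf_mul.
Proof.
move=> x; apply: pf_ext => N /=.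
by have [g _ <-] := pf_coset x N; rewrite left_coset_mul mulg1.
Qed.

Lemma pf_mulV : left_inverse (pf_embed 1) pf_inv pf_mul.
Proof.
move=> x; apply: pf_ext => N /=.
have [g _ <-] := pf_coset x N.
by rewrite left_coset_inv left_coset_mul mulVg.
Qed.

Lemma pf_mulrV : right_inverse (pf_embed 1) pf_inv pf_mul.
Proof.
move=> x; apply: pf_ext => N /=.
have [g _ <-] := pf_coset x N.
by rewrite left_coset_inv left_coset_mul mulgV.
Qed.

HB.instance Definition _ := isGroup.Build (profinite G)
  pf_mulA pf_mul1 pf_mulr1 pf_mulV pf_mulrV.

(* The topology induced by the product of the discrete quotients G/N. *)
Definition pf_subbase : set (set (profinite G)) :=
  [set U | exists (N : nfi G) (c : set G),
    U = [set x : profinite G | x N = c]].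

HB.instance Definition _ :=
  isSubBaseTopological.Build (profinite G) pf_subbase id.

HB.instance Definition _ := isPointed.Build (profinite G) 1.

End ProfiniteGroup.

Definition borel_profinite (G : groupType) :=
  g_sigma_algebraType (@open (profinite G)).

Section ResidualAverage.
Context {R : realType} {G : groupType}.

(* No regularity condition: [profinite G] is compact and, for G finitely
   generated, metrizable, so finite Borel measures on it are regular. *)
Definition is_haar (mu : probability (borel_profinite G) R) : Prop :=
  forall (g : profinite G) (A : set (profinite G)),
    measurable (A : set (borel_profinite G)) -> mu [set g * x | x in A] = mu A.

Definition nfi_closure (N : nfi G) : set (profinite G) :=
  closure [set pf_embed g | g in N].

(* The infimum is a minimum of indices, or +oo when no N qualifies. *)
Definition normal_divisibility (x : profinite G) : \bar R :=
  ereal_inf [set (subgroup_index N)%:R%:E | N in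
    [set N : nfi G | ~ nfi_closure N x]].

Definition normal_residual_average (mu : probability (borel_profinite G) R) :
    \bar R :=
  (\int[mu]_(x in [set: borel_profinite G]) normal_divisibility x)%E.

End ResidualAverage.

(* Main.v *)
Require Import Defs.
From HB Require Import structures.
From mathcomp Require Import all_boot all_order all_algebra complex.
From mathcomp Require Import all_classical all_reals all_analysis measurable_realfun.
From mathcomp Require Import finmap zify ring.

(* Let p, q be distinct odd primes and let D_k, D'_k be the kernels of the
   reductions mod p^k and mod q^k of representations of G over rings that are
   finite free over Z_(p) and Z_(q), both with infinite image. The indices
   [D_k : D_(k+1)] are bounded, and since D_1 / D_k and D'_1 / D'_k have coprime
   exponents, [G : D_k /\ D'_k] is at least a constant times
   [G : D_k][G : D'_k]. A point in the closure of D_k /\ D'_k but not in that of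
   D_(k+1) /\ D'_(k+1) has divisibility at most [G : D_(k+1)] + [G : D'_(k+1)],
   so the average is at most a constant times the sum over k of
   1/[G : D_k] + 1/[G : D'_k]. This converges: p-th powers map D_k \ D_(k+1) to
   D_(k+1) \ D_(k+2), so the indices eventually at least double.

   To obtain the representations, specialize the ring generated by the matrix
   entries, one generator at a time, keeping prescribed elements nonzero. *)

Set Implicit Arguments.
Unset Strict Implicit.
Unset Printing Implicit Defensive.

Import Order.TTheory GRing.Theory Num.Theory.

Local Open Scope ring_scope.

(* Properties shared by the nonzero finite free Z_(p)-algebras; the finite type
   [T] bounds the number of residues mod [p] and is kept separate from [E], so
   that one bound can serve a whole family of rings. *)
Record padic (p : nat) (T : finType) (E : comNzRingType) : Prop := Padic {
  padic_residue : exists r : E -> T,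
    forall x y, r x = r y -> exists z, x - y = z *+ p;
  padic_torsion_free : forall x : E, x *+ p = 0 -> x = 0;
  padic_separated : forall x : E, (forall k, exists z, x = z *+ p ^ k) -> x = 0;
  padic_unit : forall k : nat, coprime k p -> exists v : E, v *+ k = 1
}.

(** * Quotients of p-adic rings by monic polynomials *)

Lemma coef_qpolyMn (E : comNzRingType) (M : {poly E}) (z : {poly %/ M}) n i :
  (z *+ n)`_i = z`_i *+ n.
Proof.
elim: n => [|n IH]; first by rewrite !mulr0n coef0.
by rewrite !mulrSr poly_of_qpolyD coefD IH.
Qed.

(** The quotient is free over [E] on the powers of ['X], so every property is checked
    coefficientwise. The residue type depends on [M] only through its size. *)
Lemma padic_qpoly p (T : finType) (E : comNzRingType) (M : {poly E}) :
  padic p T E -> M \is monic -> (1 < size M)%N ->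
  padic p {ffun 'I_(size M).-1 -> T} {poly %/ M}.
Proof.
move=> [[r rP] tf sep un] Mm sM.
(* Quotients are formed by [mk_monic M], which falls back to ['X] unless [M] is monic and
   nonconstant. *)
have MM : mk_monic M = M :> {poly E} by rewrite /mk_monic sM Mm.
have sz (z : {poly %/ M}) i : ((size M).-1 <= i)%N -> z`_i = 0.
  move=> Hi; apply: nth_default; apply: leq_trans Hi.
  by apply: leq_trans (size_npoly z) _; rewrite MM.
split.
- exists (fun z : {poly %/ M} => [ffun i : 'I_(size M).-1 => r z`_i]) => x y xy.
  have /fin_all_exists [z zP] (i : 'I_(size M).-1) : exists z, x`_i - y`_i = z *+ p.
    by apply: rP; move/ffunP: xy => /(_ i); rewrite !ffunE.
  have szq : (size (\poly_(i < (size M).-1) oapp z 0%R (insub i))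
      <= (size (mk_monic M)).-1)%N.
    by rewrite MM size_poly.
  exists (NPoly szq); apply/npolyP => i.
  rewrite coef_qpolyMn -[RHS]/((polyseq _)`_i *+ p).
  rewrite (_ : (x - y)`_i = x`_i - y`_i); last by rewrite -coefB.
  rewrite coef_poly; case: ltnP => Hi; last by rewrite !sz // subr0 mul0rn.
  by rewrite insubT /= -zP.
- move=> x xp; apply/npolyP => i; rewrite coef0; apply: tf.
  by rewrite -coef_qpolyMn xp coef0.
- move=> x H; apply/npolyP => i; rewrite coef0; apply: sep => k.
  by have [z ->] := H k; exists z`_i; rewrite coef_qpolyMn.
- move=> k /un [v vk]; exists (qpolyC M v); apply/npolyP => i.
  rewrite coef_qpolyMn !qpolyCE /= !coefC; case: eqP => _; first by [].
  by rewrite mul0rn.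
Qed.

Lemma in_qpoly_self (E : comNzRingType) (M : {poly E}) :
  M \is monic -> (1 < size M)%N -> in_qpoly M M = 0.
Proof.
by move=> Mm sM; apply/val_inj; rewrite /= /mk_monic Mm sM Pdiv.RingMonic.rmodpp.
Qed.

Lemma padic_torsion_freeX p (T : finType) (E : comNzRingType) N (x : E) :
  padic p T E -> x *+ p ^ N = 0 -> x = 0.
Proof.
move=> [_ tf _ _]; elim: N => [//|N IH]; rewrite expnS mulnC mulrnA.
by move/tf.
Qed.

(** Monicity allows Euclidean division even if [E] has zero divisors, and each exact division by the
    nonconstant [h] shrinks the quotient, so the process stops. *)
Lemma monic_valuation (E : comNzRingType) (h A : {poly E}) :
  h \is monic -> (1 < size h)%N -> A != 0 ->
  exists j b, A = h ^+ j * b /\ Pdiv.Ring.rmodp b h != 0.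
Proof.
move=> hm sh; have [n] := ubnP (size A); elim: n A => [//|n IH] A sA A0.
have [r0|] := eqVneq (Pdiv.Ring.rmodp A h) 0; last first.
  by exists 0%N, A; rewrite expr0 mul1r.
have eA := Pdiv.RingMonic.rdivp_eq hm A; rewrite r0 addr0 in eA.
set B := Pdiv.Ring.rdivp A h in eA.
have B0 : B != 0 by apply: contra_neq A0 => B0; rewrite eA B0 mul0r.
have sB : (size B < n)%N.
  move: sA; rewrite eA mulrC size_monicM // => sA.
  by move: B0 sA sh; rewrite -size_poly_gt0; move: (size B) (size h) => u v; lia.
have [j [b [eB bh]]] := IH _ sB B0; exists j.+1, b; split=> //.
by rewrite eA eB exprS mulrC mulrA.
Qed.

(* Write A = h^j b with h not dividing b. Modulo h - p^N this is p^(Nj) b, and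
   b is congruent mod p^N to its nonzero remainder by h, so N large works. *)
Lemma qpoly_shift_neq0 p (T : finType) (E : comNzRingType) (h A : {poly E}) :
  padic p T E -> h \is monic -> (1 < size h)%N -> A != 0 ->
  exists N, [/\ (0 < N)%N, h - (p ^ N)%:R%:P \is monic,
    size (h - (p ^ N)%:R%:P) = size h &
    in_qpoly (h - (p ^ N)%:R%:P) A != 0].
Proof.
move=> pE hm sh A0.
have [j [b [eA /eqP r0]]] := monic_valuation hm sh A0.
set r := Pdiv.Ring.rmodp b h in r0.
have [i ri] : exists i, r`_i <> 0.
  by apply/not_existsP => H; apply: r0; apply/polyP => i; rewrite coef0; apply: contrapT.
(* Separatedness bounds the power of [p] dividing this nonzero coefficient. *)
have [N rN] : exists N, forall z, r`_i <> z *+ p ^ N.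
  apply: contrapT => H; apply: ri; apply: (padic_separated pE) => k.
  by apply: contrapT => H'; apply: H; exists k => z e; apply: H'; exists z.
have sM : size (h - (p ^ N)%:R%:P) = size h.
  by rewrite size_polyDl // size_polyN size_polyC; case: eqP => _; lia.
have Mm : h - (p ^ N)%:R%:P \is monic.
  rewrite monicE lead_coefDl -?monicE //.
  by rewrite size_polyN size_polyC; case: eqP => _; lia.
exists N; split => //.
  (* The exponent 0 is excluded because [p ^ 0] divides everything. *)
  by case: N rN {sM Mm} => // /(_ r`_i); rewrite expn0 mulr1n.
set M := (h - _) in Mm sM *.
have inh : in_qpoly M h = (p ^ N)%:R.
  rewrite -[h](subrK ((p ^ N)%:R%:P)) -/M rmorphD /= polyC_natr rmorph_nat.
  by rewrite in_qpoly_self ?sM ?sh // add0r.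
apply/negP => /eqP; rewrite eA rmorphM rmorphXn /= inh -natrX -expnM mulr_natl.
have pM : padic p {ffun 'I_(size M).-1 -> T} {poly %/ M}.
  by apply: padic_qpoly; rewrite ?sM.
move/(padic_torsion_freeX pM).
rewrite (Pdiv.RingMonic.rdivp_eq hm b) -/r rmorphD rmorphM /= inh mulr_natr.
move/eqP; rewrite addrC addr_eq0 => /eqP e.
apply: (rN (- (in_qpoly M (Pdiv.Ring.rdivp b h))`_i)).
rewrite -coefN.
have -> : r`_i = (in_qpoly M r)`_i.
  rewrite in_qpoly_small // /mk_monic Mm sM sh /= sM.
  by rewrite Pdiv.CommonRing.ltn_rmodpN0 ?monic_neq0.
rewrite e -mulNrn coef_qpolyMn.
by congr (_ *+ _); rewrite -coefN.
Qed.

(* The ring ev(A) has many specializations to p-adic rings: a nonzero element f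
   can be kept invertible and a further nonzero a nonzero, with a residue bound
   that does not depend on a. The ring ev(A) is handled through its presentation
   ev, so that adjoining an element just replaces A by {poly A}. *)
Definition specializable (K : fieldType) (A : comNzRingType)
    (ev : {rmorphism A -> K}) : Prop :=
  forall f, ev f != 0 -> exists P0, forall p, prime p -> (P0 < p)%N ->
  exists T : finType, forall a, ev a != 0 ->
  exists (E : comNzRingType) (psi : {rmorphism A -> E}),
    [/\ padic p T E, forall r, ev r = 0 -> psi r = 0,
        exists v, psi f * v = 1 & psi a != 0].

(** * Adjoining a transcendental element *)

Definition adjoin (K : fieldType) (A : comNzRingType) (ev : {rmorphism A -> K})
    (x : K) : {rmorphism {poly A} -> K} :=
  horner_morph (fun a => mulrC x (ev a)).

Definition to_qpoly (A E : comNzRingType) (psi : {rmorphism A -> E})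
    (M : {poly E}) : {rmorphism {poly A} -> {poly %/ M}} :=
  GRing.RMorphism.clone _ _ (in_qpoly M \o map_poly psi) _.

Lemma map_poly_ker (A E K : comNzRingType) (ev : {rmorphism A -> K})
    (psi : {rmorphism A -> E}) (q : {poly A}) :
  (forall r, ev r = 0 -> psi r = 0) -> map_poly ev q = 0 -> map_poly psi q = 0.
Proof.
move=> kp /polyP q0; apply/polyP => i; rewrite coef_map coef0.
apply: kp; by have := q0 i; rewrite coef_map coef0.
Qed.

(** Coefficients beyond the degree of the image under [ev] die under [ev], hence under [psi]; the
    one at that degree survives by hypothesis. *)
Lemma size_map_ker (A E K : comNzRingType) (ev : {rmorphism A -> K})
    (psi : {rmorphism A -> E}) (q : {poly A}) :
  (forall r, ev r = 0 -> psi r = 0) ->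
  psi q`_(size (map_poly ev q)).-1 != 0 -> map_poly ev q != 0 ->
  size (map_poly psi q) = size (map_poly ev q).
Proof.
move=> kp qn q0; apply/eqP; rewrite eqn_leq; apply/andP; split.
  apply/leq_sizeP => j /leq_sizeP /(_ _ (leqnn _)).
  by rewrite !coef_map => /kp.
have := q0; rewrite -size_poly_gt0 => sq.
rewrite -(prednK sq) ltnNge; apply: contra qn => /leq_sizeP /(_ _ (leqnn _)).
by rewrite coef_map => ->.
Qed.

(* After scaling, 'X * f becomes a monic F over E; sending x to a root of
   F = 1 + p^N keeps f invertible, whatever N is. *)
Lemma specializable_transcendental (K : fieldType) (A : comNzRingType)
    (ev : {rmorphism A -> K}) (x : K) :
  specializable ev ->
  (forall q, (map_poly ev q).[x] = 0 -> map_poly ev q = 0) ->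
  specializable (adjoin ev x).
Proof.
move=> sp tr f fx.
have q0 : map_poly ev f != 0.
  by apply: contra_neq fx => f0; rewrite /adjoin /= /horner_morph f0 horner0.
set d := (size (map_poly ev f)).-1.
have sq : size (map_poly ev f) = d.+1 by rewrite prednK // size_poly_gt0.
(* The leading coefficient of the image of [f] is to be inverted, that of [a] kept nonzero. *)
have fd : ev f`_d != 0 by rewrite -coef_map -lead_coefE lead_coef_eq0.
have [P0 HP] := sp _ fd; exists P0 => p pp /(HP p pp) [T HT].
(* The modulus [M] below has size [d.+2] for every [a] and [N], so the residue type can be fixed
   before [a]. *)
exists {ffun 'I_d.+1 -> T} => a ax.
have a0 : map_poly ev a != 0.
  by apply: contra_neq ax => a0; rewrite /adjoin /= /horner_morph a0 horner0.
have := a0; rewrite -lead_coef_eq0 lead_coefE coef_map => /HT.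
move=> [E [psi [pE kp [v uv] ai]]].
have A0 : map_poly psi a != 0.
  apply: contra_neq ai => /(congr1 (coefp (size (map_poly ev a)).-1)).
  by rewrite /= coef_map coef0.
have sf : size (map_poly psi f) = d.+1.
  rewrite (size_map_ker (ev := ev)) //.
  by apply/eqP => e; move: uv; rewrite e mul0r => /esym/eqP; rewrite oner_eq0.
have uv' : v * psi f`_d = 1 by rewrite mulrC.
have lF : lead_coef (v *: map_poly psi f) = 1 /\ size (v *: map_poly psi f) = d.+1.
  have l1 : (v *: map_poly psi f)`_d = 1 by rewrite coefZ coef_map.
  have : size (v *: map_poly psi f) = d.+1.
    apply/eqP; rewrite eqn_leq -{1}sf size_scale_leq /= ltnNge.
    apply/negP => /leq_sizeP /(_ _ (leqnn _)) /eqP.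
    by rewrite l1 oner_eq0.
  by move=> s; rewrite lead_coefE s.
(* The factor ['X] keeps [F - 1] nonconstant even when [d] is 0. *)
set F : {poly E} := (v *: map_poly psi f) * 'X.
have sF : size F = d.+2.
  by rewrite size_mulX ?lF.2 // -size_poly_gt0 lF.2.
have mF : F \is monic by rewrite monicE lead_coefMX lF.1.
have sh : size (F - 1) = d.+2.
  by rewrite size_polyDl // size_polyN size_poly1 sF.
have mh : F - 1 \is monic.
  by rewrite monicE lead_coefDl ?(eqP mF) // size_polyN size_poly1 sF.
have sh1 : (1 < size (F - 1)%R)%N by rewrite sh.
have [N [N0 Mm sM AM]] := qpoly_shift_neq0 pE mh sh1 A0.
set M := F - 1 - _ in Mm sM AM.
exists {poly %/ M}, (to_qpoly psi M).
have pM : padic p {ffun 'I_d.+1 -> T} {poly %/ M}.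
  by have := padic_qpoly pE Mm; rewrite sM sh; apply.
split => //.
- move=> r /= /tr /(map_poly_ker kp) /= ->.
  by rewrite in_qpoly0.
(* Modulo [M], [F] becomes [1 + p ^ N], which is prime to [p] because [N] is positive, hence a
   unit. *)
- have [|w wE] := padic_unit pM (k := (p ^ N).+1).
    rewrite coprime_sym prime_coprime // -addn1 dvdn_addr ?dvdn_exp //.
    by rewrite dvdn1; case: eqP pp => // ->.
  exists (in_qpoly M (v *: 'X) * w).
  rewrite mulrA /= -rmorphM /= -scalerAr scalerAl -/F.
  have -> : F = M + ((p ^ N).+1)%:R by rewrite /M polyC_natr -natr1; ring.
  rewrite rmorphD rmorph_nat /=.
  by rewrite in_qpoly_self ?sM ?sh // add0r mulr_natl.
Qed.

(** * Adjoining an algebraic element *)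

Section AlgebraicElement.
Variables (K : fieldType) (A : comNzRingType) (ev : {rmorphism A -> K}) (x : K).

(** Since [ev] may have a kernel, [q] can be longer than its image; the excess coefficients are
    dropped. *)
Lemma truncate_map_poly (q : {poly A}) :
  exists q', map_poly ev q' = map_poly ev q /\ size q' = size (map_poly ev q).
Proof.
set n := size (map_poly ev q); exists (take_poly n q).
have e : map_poly ev (take_poly n q) = map_poly ev q.
  apply/polyP => i; rewrite !coef_map coef_take_poly.
  case: ltnP => // ni; rewrite raddf0 -coef_map.
  by rewrite nth_default.
split=> //; apply/eqP; rewrite eqn_leq size_take_poly /= /n -{1}e.
exact: size_poly.
Qed.

(** A denominator-free lift of the minimal polynomial of [x] over the fraction field of ev(A), in
    general not monic. *)
Definition min_annihilator (P : {poly A}) : Prop :=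
  [/\ size P = size (map_poly ev P), P != 0, adjoin ev x P = 0
    & forall q, map_poly ev q != 0 -> adjoin ev x q = 0 ->
      (size P <= size (map_poly ev q))%N].

Lemma min_annihilator_exists (q0 : {poly A}) :
  map_poly ev q0 != 0 -> adjoin ev x q0 = 0 -> exists P, min_annihilator P.
Proof.
move=> q00 q0x.
pose S n := `[< exists q, [/\ map_poly ev q != 0, adjoin ev x q = 0
                             & size (map_poly ev q) = n] >].
have exS : exists n, S n by exists (size (map_poly ev q0)); apply/asboolP; exists q0.
case: (ex_minnP exS) => n /asboolP [q [qn qx sq]] nmin.
have [P [eP sP]] := truncate_map_poly q.
exists P; split; rewrite ?eP //.
- by rewrite -size_poly_gt0 sP size_poly_gt0.
- by move: qx; rewrite /adjoin /= /horner_morph eP.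
- by move=> r rn rx; rewrite sP sq; apply: nmin; apply/asboolP; exists r.
Qed.

Lemma ev_lead_coef (P : {poly A}) : size P = size (map_poly ev P) -> P != 0 ->
  ev (lead_coef P) != 0.
Proof.
move=> sP P0; rewrite lead_coefE sP -coef_map -lead_coefE lead_coef_eq0.
by rewrite -size_poly_gt0 -sP size_poly_gt0.
Qed.

Variables (P : {poly A}) (minP : min_annihilator P).

Lemma min_annihilator_size : (1 < size P)%N.
Proof.
have [sP P0 Px _] := minP.
rewrite ltnNge; apply/negP => /size1_polyC eP.
move: (ev_lead_coef sP P0) Px; rewrite eP lead_coefC /adjoin /= /horner_morph.
by rewrite map_polyC hornerC => /eqP.
Qed.

(* Pseudo-division of P by f: the remainder is smaller than f, and it does not
   vanish at x since otherwise the quotient would contradict minimality of P. *)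
Lemma pseudo_norm_small n (f : {poly A}) : (size (map_poly ev f) < n)%N ->
  (size (map_poly ev f) < size P)%N -> adjoin ev x f != 0 ->
  exists g b, ev b != 0 /\ adjoin ev x (f * g) = ev b.
Proof.
have [sP P0 Px minPP] := minP.
elim: n f => [//|n IH] f0 sn sP0 fx0.
have [f [ef sf]] := truncate_map_poly f0.
have efx : adjoin ev x f = adjoin ev x f0 by rewrite /adjoin /= /horner_morph ef.
suff : exists g b, ev b != 0 /\ adjoin ev x (f * g) = ev b.
  by move=> [g [b [b0 e]]]; exists g, b; rewrite rmorphM -efx -rmorphM.
rewrite -efx in fx0; rewrite -sf in sn sP0; rewrite -ef in sf.
have fn : f != 0 by apply: contra_neq fx0 => ->; rewrite rmorph0.
have [s1|s1] := leqP (size f) 1.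
  exists 1, f`_0; rewrite mulr1; rewrite [f in adjoin _ _ f](size1_polyC s1).
  rewrite /adjoin /= /horner_morph map_polyC hornerC; split=> //.
  apply: contra_neq fx0; rewrite (size1_polyC s1) coefC eqxx.
  by rewrite /adjoin /= /horner_morph map_polyC hornerC.
have := Pdiv.ComRing.rdivp_eq f P.
set c := lead_coef f ^+ _; set Q := Pdiv.Ring.rdivp _ _; set r := Pdiv.Ring.rmodp _ _.
move=> eQ.
have c0 : ev c != 0 by rewrite rmorphXn expf_neq0 // ev_lead_coef.
have sr : (size r < size f)%N by apply: Pdiv.CommonRing.ltn_rmodpN0.
have srm : (size (map_poly ev r) <= size r)%N by apply: size_poly.
have eQx : adjoin ev x f * adjoin ev x Q = - adjoin ev x r.
  apply/eqP; rewrite -addr_eq0 mulrC -rmorphM -rmorphD -eQ -mul_polyC rmorphM.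
  by rewrite Px mulr0.
have eQm : map_poly ev Q * map_poly ev f = ev c *: map_poly ev P - map_poly ev r.
  by rewrite -map_polyZ eQ rmorphD rmorphM /= addrK.
have rx : adjoin ev x r != 0.
  apply/negP => /eqP rx; move/eqP: eQx; rewrite rx oppr0 mulf_eq0 (negPf fx0) /=.
  move=> /eqP Qx.
  have sL : size (ev c *: map_poly ev P - map_poly ev r) = size P.
    rewrite size_polyDl size_scale ?sP // size_polyN -sP.
    by apply: leq_ltn_trans srm _; apply: ltn_trans sr _.
  have Qn : map_poly ev Q != 0.
    apply/negP => /eqP Q0; move: sL; rewrite -eQm Q0 mul0r size_poly0 => /esym/eqP.
    by rewrite size_poly_eq0 (negPf P0).
  have fm : map_poly ev f != 0 by rewrite -size_poly_gt0 -sf size_poly_gt0.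
  have := minPP Q Qn Qx; move: sL; rewrite -eQm size_mul // -sf.
  move: (size (map_poly ev Q)) (size f) (size P) s1 => u v w; lia.
have [||g [b [b0 e]]] := IH r _ _ rx.
- by apply: leq_ltn_trans srm _; apply: leq_trans sr _; rewrite -ltnS.
- by apply: leq_ltn_trans srm _; apply: ltn_trans sr _.
(* At [x], [f * - Q] equals [r], so a cofactor for [r] gives one for [f]. *)
exists (- Q * g), b; split=> //.
by rewrite -e mulrA mulrN !rmorphM rmorphN rmorphM eQx opprK.
Qed.

(** Pseudo-division by [P] reduces to the previous lemma, since at [x] the remainder is [f] times a
    nonzero constant. Like a norm, [b] transfers invertibility and nonvanishing from the extension
    to ev(A). *)
Lemma pseudo_norm (f : {poly A}) : adjoin ev x f != 0 ->
  exists g b, ev b != 0 /\ adjoin ev x (f * g) = ev b.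
Proof.
have [sP P0 Px minPP] := minP; move=> fx.
have := Pdiv.ComRing.rdivp_eq P f.
set c := lead_coef P ^+ _; set Q := Pdiv.Ring.rdivp _ _; set r := Pdiv.Ring.rmodp _ _.
move=> eQ.
have c0 : ev c != 0 by rewrite rmorphXn expf_neq0 // ev_lead_coef.
have rx : adjoin ev x r = ev c * adjoin ev x f.
  have := congr1 (adjoin ev x) eQ; rewrite -mul_polyC rmorphD !rmorphM.
  rewrite Px mulr0 add0r => <-.
  by rewrite /adjoin /= /horner_morph map_polyC hornerC.
have [||g [b [b0 e]]] := pseudo_norm_small (ltnSn _) _ (_ : adjoin ev x r != 0).
- apply: leq_ltn_trans (size_poly _ _) _; exact: Pdiv.CommonRing.ltn_rmodpN0.
- by rewrite rx mulf_neq0.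
exists (c%:P * g), b; split=> //; rewrite -e !rmorphM rx mulrCA mulrA; congr (_ * _ * _).
by rewrite /adjoin /= /horner_morph map_polyC hornerC.
Qed.

(** Minimality of [P] forces the pseudo-remainder of [q] to vanish. The power of the leading
    coefficient is harmless once that coefficient specializes to a unit. *)
Lemma adjoin_ker (q : {poly A}) : adjoin ev x q = 0 ->
  exists k Q r, lead_coef P ^+ k *: q = Q * P + r /\ map_poly ev r = 0.
Proof.
have [sP P0 Px minPP] := minP; move=> qx.
have eQ := Pdiv.ComRing.rdivp_eq P q.
exists (Pdiv.Ring.rscalp q P), (Pdiv.Ring.rdivp q P), (Pdiv.Ring.rmodp q P); split=> //.
have [//|rn] := eqVneq (map_poly ev (Pdiv.Ring.rmodp q P)) 0.
have /minPP : adjoin ev x (Pdiv.Ring.rmodp q P) = 0.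
  have := congr1 (adjoin ev x) eQ; rewrite -mul_polyC rmorphD !rmorphM.
  rewrite Px mulr0 add0r => <-.
  by rewrite qx mulr0.
move=> /(_ rn); rewrite leqNgt (leq_ltn_trans (size_poly _ _)) //.
exact: Pdiv.CommonRing.ltn_rmodpN0.
Qed.

End AlgebraicElement.

(* The specialized ring is E[X]/(P) with P made monic; divisibility questions in
   {poly A} are moved to A by [pseudo_norm]. *)
Lemma specializable_algebraic (K : fieldType) (A : comNzRingType)
    (ev : {rmorphism A -> K}) (x : K) (P : {poly A}) :
  specializable ev -> min_annihilator ev x P -> specializable (adjoin ev x).
Proof.
move=> sp minP f fx; have [sP P0 Px minPP] := minP.
have [g [b [b0 e]]] := pseudo_norm minP fx.
set l := lead_coef P.
have l0 : ev l != 0 by apply: ev_lead_coef.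
(* Inverting [l] makes [P] monic up to a unit; inverting [b] makes [f] invertible. *)
have lb0 : ev (l * b) != 0 by rewrite rmorphM mulf_neq0.
have [p0 HP] := sp _ lb0; exists p0 => p pp /(HP p pp) [T HT].
set d := (size P).-1.
have sPd : size P = d.+1 by rewrite prednK // size_poly_gt0.
have d0 : (0 < d)%N by have := min_annihilator_size minP; rewrite sPd.
exists {ffun 'I_d -> T} => a /(pseudo_norm minP) [a2 [b2 [b20 ea]]].
(* Keeping [b2] nonzero suffices for [a], because [a * a2] is sent to the constant [psi b2]. *)
have [E [psi [pE kp [v uv] b2n]]] := HT _ b20.
have lE : l = P`_d by [].
pose w := v * psi b.
have wl : w * psi l = 1 by rewrite -uv rmorphM /w; ring.
have sM : size (map_poly psi P) = d.+1.
  rewrite (size_map_ker (ev := ev)) -?sP //.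
    by apply/eqP => z; move: wl; rewrite lE z mulr0 => /esym/eqP; rewrite oner_eq0.
  by rewrite -size_poly_gt0 -sP size_poly_gt0.
set M := w *: map_poly psi P.
have Md : M`_d = 1 by rewrite coefZ coef_map.
have sMd : size M = d.+1.
  apply/eqP; rewrite eqn_leq -{1}sM size_scale_leq /= ltnNge.
  by apply/negP => /leq_sizeP /(_ _ (leqnn _)) /eqP; rewrite Md oner_eq0.
have Mm : M \is monic by rewrite monicE lead_coefE sMd Md.
have inM : in_qpoly M (map_poly psi P) = 0.
  have -> : map_poly psi P = psi l *: M by rewrite scalerA mulrC wl scale1r.
  rewrite -mul_polyC rmorphM /=.
  by rewrite in_qpoly_self ?sMd // mulr0.
have ker q : adjoin ev x q = 0 -> to_qpoly psi M q = 0.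
  move=> /(adjoin_ker minP) [k [Q [r [eq /(map_poly_ker kp) r0]]]].
  have := congr1 (to_qpoly psi M) eq.
  rewrite -mul_polyC rmorphD !rmorphM /= r0 inM mulr0 rmorph0 addr0 map_polyC /=.
  move=> z; have := congr1 (fun y => in_qpoly M (w ^+ k)%:P * y) z.
  rewrite /= mulr0 mulrA -!in_qpolyM -polyCM rmorphXn -exprMn wl expr1n.
  by rewrite polyC1 mul1r.
have toC c : to_qpoly psi M c%:P = qpolyC M (psi c).
  have -> : to_qpoly psi M c%:P = in_qpoly M (psi c)%:P by rewrite /= map_polyC.
  apply/val_inj; apply: (@in_qpoly_small _ M); rewrite size_polyC.
  by apply: leq_ltn_trans (size_mk_monic_gt1 M); case: (_ != _).
have kerE q1 q2 :
    adjoin ev x q1 = adjoin ev x q2 -> to_qpoly psi M q1 = to_qpoly psi M q2.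
  move=> /eqP; rewrite -subr_eq0 -rmorphB => /eqP /ker.
  by rewrite rmorphB => /eqP; rewrite subr_eq0 => /eqP.
have adjC c : adjoin ev x c%:P = ev c.
  by rewrite /adjoin /= /horner_morph map_polyC hornerC.
exists {poly %/ M}, (to_qpoly psi M); split=> //.
- by have := padic_qpoly pE Mm; rewrite sMd; apply.
(* At [x], [f * g * l] equals the constant [l * b], whose image has inverse [v]. *)
- exists (to_qpoly psi M (g * ((lead_coef P)%:P) ) * qpolyC M v).
  have e2 : adjoin ev x (f * (g * (lead_coef P)%:P)) = adjoin ev x (lead_coef P * b)%:P.
    by rewrite mulrA rmorphM e !adjC rmorphM mulrC.
  by rewrite mulrA -rmorphM (kerE _ _ e2) toC -qpolyCM uv.
- apply/negP => /eqP a0.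
  have : to_qpoly psi M (a * a2) = 0 by rewrite rmorphM a0 mul0r.
  rewrite -(adjC b2) in ea; rewrite (kerE _ _ ea) toC => z.
  have := congr1 (fun q : {poly %/ M} => q`_0) z.
  by rewrite coef0 qpolyCE coefC eqxx => /eqP; apply/negP.
Qed.

(** * Integers localized at a prime, as base of the specializations *)

Section LocalizedIntegers.
Variable p : nat.

(** Some denominator prime to [p] is asked for, rather than the reduced one, so that ring closure
    needs no reduction of fractions. *)
Definition local_int_pred : {pred rat} := fun x =>
  `[< exists (n : int) (d : nat), [/\ coprime d p, (0 < d)%N & x * d%:R = n%:~R] >].

Fact local_int_subring_closed : subring_closed local_int_pred.
Proof.
split.
- by apply/asboolP; exists 1, 1%N; split => //; rewrite ?coprime1n // mulr1.
- move=> x y /asboolP [n [d [cd d0 e]]] /asboolP [n' [d' [cd' d0' e']]].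
  apply/asboolP; exists (n * d'%:R - n' * d%:R), (d * d')%N; split.
  + by rewrite coprimeMl cd.
  + by rewrite muln_gt0 d0.
  + by rewrite natrM rmorphB !rmorphM /= !rmorph_nat -e -e'; ring.
- move=> x y /asboolP [n [d [cd d0 e]]] /asboolP [n' [d' [cd' d0' e']]].
  apply/asboolP; exists (n * n'), (d * d')%N; split.
  + by rewrite coprimeMl cd.
  + by rewrite muln_gt0 d0.
  + by rewrite natrM !rmorphM /= -e -e'; ring.
Qed.

HB.instance Definition _ :=
  GRing.isSubringClosed.Build rat local_int_pred local_int_subring_closed.

Record local_int := LocalInt {
  local_int_val :> rat; _ : local_int_pred local_int_val }.

HB.instance Definition _ := [isSub for local_int_val].
HB.instance Definition _ := [Choice of local_int by <:].
HB.instance Definition _ := [SubChoice_isSubComNzRing of local_int by <:].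

Lemma local_intP (x : local_int) :
  exists (n : int) (d : nat), [/\ coprime d p, (0 < d)%N & val x * d%:R = n%:~R].
Proof. by case: x => x /= /asboolP. Qed.

Lemma local_int_frac (n : int) (d : nat) : coprime d p -> (0 < d)%N ->
  exists x : local_int, val x = n%:~R / d%:R.
Proof.
move=> cd d0; have xP : local_int_pred (n%:~R / d%:R).
  by apply/asboolP; exists n, d; split => //; rewrite divfK // pnatr_eq0 -lt0n.
by exists (LocalInt xP).
Qed.

Lemma local_int_valB (x y : local_int) : val (x - y) = val x - val y.
Proof. by []. Qed.

Lemma local_int_valMn (x : local_int) n : val (x *+ n) = val x *+ n.
Proof. exact: (raddfMn (val : {rmorphism local_int -> rat})). Qed.

Lemma local_int_padic : prime p -> padic p 'I_p local_int.
Proof.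
move=> pp; have p0 : (0 < p)%N := prime_gt0 pp.
have resid (x : local_int) :
    exists i : 'I_p, exists z : local_int, x - (i : nat)%:R = z *+ p.
  have [n [d [cd d0 e]]] := local_intP x.
  have dn0 : d%:R != 0 :> rat by rewrite pnatr_eq0 -lt0n.
  (* As [u] inverts [d] modulo [p], the residue of [n / d] is that of [n * u]. *)
  have [[u v] /= uv] := coprimezP d p cd.
  pose m := n * u; pose i := `|(m %% p)%Z|%N.
  have pz : (p : int) != 0 by lia.
  have ip : (i < p)%N.
    by rewrite -ltz_nat /i gez0_abs ?modz_ge0 ?ltz_pmod.
  have iE : (i : int) = m - (m %/ p)%Z * p.
    by rewrite /i gez0_abs ?modz_ge0.
  have nE : n - (i : int) * d = (n * v + (m %/ p)%Z * d) * p.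
    rewrite iE /m -{1}[n]mulr1 -[1]uv; ring.
  exists (Ordinal ip).
  have [z zE] := local_int_frac (n * v + (m %/ p)%Z * d) cd d0.
  exists z; apply/val_inj; rewrite local_int_valB !local_int_valMn zE -[val 1]/(1 : rat).
  apply: (mulIf dn0); rewrite mulrBl e [RHS]mulrnAl divfK // -[RHS]mulr_natr.
  have := congr1 (fun t : int => t%:~R : rat) nE.
  by rewrite /= rmorphB !rmorphM /= -!pmulrn.
have [r rP] := choice resid.
split.
- exists r => x y xy; have [zx ex] := rP x; have [zy ey] := rP y.
  exists (zx - zy); rewrite mulrnBl -ex -ey xy; ring.
- move=> x /(congr1 val); rewrite local_int_valMn -[val 0]/(0 : rat) => /eqP.
  rewrite -mulr_natr mulf_eq0 pnatr_eq0 (gtn_eqF p0) orbF => /eqP e.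
  by apply/val_inj; rewrite e -[val 0]/(0 : rat).
- move=> x H; have [n [d [cd d0 e]]] := local_intP x.
  have dn0 : d%:R != 0 :> rat by rewrite pnatr_eq0 -lt0n.
  suff n0 : n = 0.
    apply/val_inj; rewrite -[val 0]/(0 : rat); apply: (mulIf dn0).
    by rewrite e n0 mul0r.
  (* The power of [p] whose exponent is the absolute value of [n] exceeds that value, so it cannot
     divide a nonzero [n]. *)
  apply: contrapT => /eqP n0; have [z ez] := H `|n|%N.
  have [n' [d' [cd' d0' e']]] := local_intP z.
  have E : n * d' = n' * d * (p ^ `|n|)%N.
    apply/eqP; rewrite -(eqr_int rat) !rmorphM /= -!pmulrn -e -e' ez local_int_valMn.
    by rewrite -mulr_natr; apply/eqP; ring.
  have : (p ^ `|n| %| `|n| * d')%N.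
    by rewrite -[d']/(`|Posz d'|)%N -abszM E abszM dvdn_mull.
  rewrite Gauss_dvdl; last by rewrite coprimeXl // coprime_sym.
  move/dvdn_leq; rewrite absz_gt0 n0 => /(_ isT).
  by rewrite leqNgt ltn_expl // prime_gt1.
- move=> k ck; have k0 : (0 < k)%N.
    by case: k ck => //; rewrite /coprime gcd0n; case: eqP pp => // ->.
  have [v vE] := local_int_frac 1 ck k0; exists v.
  apply/val_inj; rewrite local_int_valMn vE mulr1z mul1r -[LHS]mulr_natr mulVf //.
  by rewrite pnatr_eq0 -lt0n.
Qed.

End LocalizedIntegers.

(** A prime larger than the absolute value of [f] does not divide [f], and no nonzero integer
    vanishes in the localization. *)
Lemma specializable_int (K : fieldType) :
  (forall n : nat, n.+1%:R != 0 :> K) ->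
  specializable (GRing.RMorphism.clone _ _ (intr : int -> K) _).
Proof.
move=> ch f f0; exists `|f|%N => p pp fp; exists 'I_p => a a0.
have ker (z : int) : z%:~R = 0 :> K -> z = 0.
  case: z => [[|n]|n] //= e; case/eqP: (ch n); first exact: e.
  by apply/eqP; rewrite -oppr_eq0; apply/eqP.
exists (local_int p), (GRing.RMorphism.clone _ _ (intr : int -> local_int p) _).
split.
- exact: local_int_padic.
- by move=> r /ker ->; rewrite rmorph0.
- have fn : f != 0 by apply: contra_neq f0 => ->.
  have cf : coprime `|f| p.
    rewrite coprime_sym prime_coprime //; apply/negP => /dvdn_leq.
    by rewrite absz_gt0 fn => /(_ isT); rewrite leqNgt fp.
  have [v vf] := padic_unit (local_int_padic pp) cf.
  case: f fn vf {f0 fp cf} => n _ vf.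
    by exists v; rewrite -[RHS]vf -[RHS]mulr_natl.
  by exists (- v); rewrite -[RHS]vf /= mulrNN -[RHS]mulr_natl.
- apply/negP => /eqP az; have := rmorph_int (val : {rmorphism local_int p -> rat}) a.
  rewrite -[a%:~R]/((GRing.RMorphism.clone _ _ (intr : int -> local_int p) _) a) az.
  move=> /esym/eqP; rewrite -[_ 0]/(0 : rat) intr_eq0 => /eqP a00.
  by move: a0; rewrite a00 /= eqxx.
Qed.

(** Each new element is either algebraic or transcendental over the ring already built, and both
    cases preserve specializability. *)
Lemma specializable_seq (K : fieldType) (xs : seq K) :
  (forall n : nat, n.+1%:R != 0 :> K) ->
  exists (A : comNzRingType) (ev : {rmorphism A -> K}),
    specializable ev /\ forall x, x \in xs -> exists r, ev r = x.
Proof.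
move=> ch; elim: xs => [|x xs [A [ev [sp im]]]].
  exists int, (GRing.RMorphism.clone _ _ (intr : int -> K) _).
  by split=> //; exact: specializable_int.
exists {poly A}, (adjoin ev x); split; last first.
  move=> y; rewrite inE => /orP [/eqP ->|/im [r <-]].
    by exists 'X; rewrite /adjoin /= /horner_morph map_polyX hornerX.
  by exists r%:P; rewrite /adjoin /= /horner_morph map_polyC hornerC.
have [[q q0 qx]|H] := pselect (exists2 q, map_poly ev q != 0 & adjoin ev x q = 0).
  have [P minP] := min_annihilator_exists q0 qx.
  exact: specializable_algebraic sp minP.
apply: specializable_transcendental sp _ => q qx.
by apply: contrapT => /eqP q0; apply: H; exists q.
Qed.

(** * Congruence representations of linear groups *)

(** The element [g] witnesses an infinite image: for odd [p], its iterated [p]-th powers stay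
    nontrivial and become congruent to 1 modulo every power of [p]. *)
Definition congruence_rep (p : nat) (G : groupType) : Prop :=
  exists (m : nat) (E : comNzRingType) (T : finType) (phi : G -> 'M[E]_m),
  [/\ padic p T E, phi 1%g = 1%:M, {morph phi : g h / (g * h)%g >-> g *m h} &
    exists g Z, phi g = 1%:M + Z *+ p /\ phi g <> 1%:M].

Lemma matrix_residue p (T : finType) (E : comNzRingType) m n : padic p T E ->
  exists r : 'M[E]_(m, n) -> {ffun 'I_m * 'I_n -> T},
    forall X Y, r X = r Y -> exists Z, X - Y = Z *+ p.
Proof.
move=> [[r rP] _ _ _]; exists (fun X => [ffun ij => r (X ij.1 ij.2)]) => X Y XY.
have /fin_all_exists [z zP] (ij : 'I_m * 'I_n) :
    exists z, X ij.1 ij.2 - Y ij.1 ij.2 = z *+ p.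
  by apply: rP; move/ffunP: XY => /(_ ij); rewrite !ffunE.
exists (\matrix_(i, j) z (i, j)); apply/matrixP => i j.
by rewrite mulmxnE !mxE -(zP (i, j)).
Qed.

(** Asking that both [rho g] and the image of the inverse lift makes the liftable elements a
    subgroup. *)
Lemma linear_lift (K : fieldType) (A : comNzRingType) (ev : {rmorphism A -> K})
    (G : groupType) (m : nat) (rho : G -> 'M[K]_m) (s : seq G) :
  {morph rho : x y / (x * y)%g >-> x *m y} -> rho 1%g = 1%:M ->
  (forall H : set G, subgroup H -> ([set` s] `<=` H)%classic -> H = [set: G]%classic) ->
  (forall g, g \in s -> exists X, map_mx ev X = rho g) ->
  (forall g, g \in s -> exists X, map_mx ev X = rho (g^-1)%g) ->
  forall g, exists X, map_mx ev X = rho g.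
Proof.
move=> rM r1 gen sp sn.
pose H : set G := [set g | (exists X, map_mx ev X = rho g) /\
                           (exists X, map_mx ev X = rho (g^-1)%g)]%classic.
have HG : H = [set: G]%classic.
  apply: gen; last by move=> g gs; split; [exact: sp|exact: sn].
  split.
  - by split; exists 1%:M; rewrite ?invg1 r1 map_mx1.
  - move=> x y [[X eX] [X' eX']] [[Y eY] [Y' eY']]; split.
      by exists (X *m Y); rewrite map_mxM eX eY rM.
    by exists (Y' *m X'); rewrite map_mxM eX' eY' invgM rM.
  - by move=> x [? ?]; split => //; rewrite invgK.
by move=> g; have [] : H g by rewrite HG.
Qed.

(* No injective specialization is needed: one separating more elements of G than
   there are residues already yields a nontrivial element congruent to 1 mod p. *)
Lemma linear_congruence_rep (K : fieldType) (G : groupType) :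
  (forall n : nat, n.+1%:R != 0 :> K) ->
  infinite_set [set: G]%classic -> finitely_generated G -> linear_group K G ->
  exists P0, forall p, prime p -> (P0 < p)%N -> congruence_rep p G.
Proof.
move=> ch inf [s gen] [m [rho [rinj runit r1 rM]]].
pose ents (g : G) : seq K := [seq rho g ij.1 ij.2 | ij : 'I_m * 'I_m].
have [A [ev [sp im]]] := specializable_seq
  (flatten [seq ents g | g <- s] ++ flatten [seq ents (g^-1)%g | g <- s]) ch.
have lift_of g : (forall i j, exists r, ev r = rho g i j) ->
    exists X, map_mx ev X = rho g.
  move=> H; have /fin_all_exists [z zP] (ij : 'I_m * 'I_m) :
    exists r, ev r = rho g ij.1 ij.2 by apply: H.
  by exists (\matrix_(i, j) z (i, j)); apply/matrixP => i j; rewrite !mxE zP.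
have [||L LP] := choice (linear_lift rM r1 gen (ev := ev) _ _).
- move=> g gs; apply: lift_of => i j; apply: im; rewrite mem_cat; apply/orP; left.
  apply/flattenP; exists (ents g); first exact: map_f.
  by apply/mapP; exists (i, j); rewrite ?mem_enum.
- move=> g gs; apply: lift_of => i j; apply: im; rewrite mem_cat; apply/orP; right.
  apply/flattenP; exists (ents (g^-1)%g); first exact: (map_f (fun g => ents (g^-1)%g)).
  by apply/mapP; exists (i, j); rewrite ?mem_enum.
have ev1 : ev 1 != 0 by rewrite rmorph1 oner_eq0.
have [P0 HP] := sp 1 ev1; exists P0 => p pp /(HP p pp) [T HT].
(* The residue bound is known before [a] is chosen, so [a] can separate [N.+1] elements, one more
   than there are matrix residues. *)
set N := #|{ffun 'I_m * 'I_m -> T}|.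
have [h hinj] : exists h : nat -> G, injective h.
  pose Gp : pointedType := HB.pack (Choice.sort G) (isPointed.Build (Choice.sort G) 1%g).
  have inf' : infinite_set [set: Gp]%classic by [].
  move/infiniteP/pcard_injP: inf' => [h hinj].
  by exists h => x y; apply: hinj; exact: mem_set.
have sep0 i j : i != j -> exists kl : 'I_m * 'I_m,
    ev (L (h i) kl.1 kl.2 - L (h j) kl.1 kl.2) != 0.
  move=> ne; apply: contrapT => H; move/eqP: ne; apply; apply: hinj; apply: rinj.
  rewrite -!LP; apply/matrixP => k l; rewrite !mxE; apply/eqP.
  rewrite -subr_eq0 -rmorphB; apply: contrapT => /negP ne.
  by apply: H; exists (k, l).
have [kl0 _] := sep0 0%N 1%N isT.
have sep (ij : 'I_N.+1 * 'I_N.+1) : exists kl : 'I_m * 'I_m,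
    ij.1 != ij.2 -> ev (L (h ij.1) kl.1 kl.2 - L (h ij.2) kl.1 kl.2) != 0.
  have [e|ne] := eqVneq ij.1 ij.2; first by exists kl0.
  by have [kl klP] := sep0 _ _ ne; exists kl.
have [kl klP] := choice sep.
pose a := \prod_(ij : 'I_N.+1 * 'I_N.+1 | ij.1 != ij.2)
  (L (h ij.1) (kl ij).1 (kl ij).2 - L (h ij.2) (kl ij).1 (kl ij).2).
have [|E [psi [pE kp _ ap]]] := HT a.
  by rewrite rmorph_prod; apply/prodf_neq0 => ij; exact: klP.
pose phi g := map_mx psi (L g).
(* Two lifts differ by entries in the kernel of [ev], which [psi] kills; this makes [phi]
   multiplicative although [L] need not be. *)
have phiE g X : map_mx ev X = rho g -> phi g = map_mx psi X.
  move=> eX; apply/matrixP => i j; rewrite !mxE; apply/eqP.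
  rewrite -subr_eq0 -rmorphB; apply/eqP/kp; rewrite rmorphB.
  have := congr1 (fun Y : 'M[_]_m => Y i j) (etrans (LP g) (esym eX)).
  by rewrite !mxE => ->; rewrite subrr.
have phi1 : phi 1%g = 1%:M by rewrite (phiE _ 1%:M) ?map_mx1.
have phiM : {morph phi : x y / (x * y)%g >-> x *m y}.
  by move=> x y; rewrite (phiE _ (L x *m L y)) ?map_mxM // !LP rM.
exists m, E, T, phi; split => //.
have phi_inj (i j : 'I_N.+1) : i != j -> phi (h i) != phi (h j).
  move=> ne; apply: contra ap => /eqP e.
  rewrite /a rmorph_prod (bigD1 (i, j)) //= rmorphB.
  have := congr1 (fun Y : 'M[_]_m => Y (kl (i, j)).1 (kl (i, j)).2) e.
  by rewrite !mxE => ->; rewrite subrr mul0r.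
have [r rP] := matrix_residue m m pE.
have ninj : ~~ injectiveb (fun i : 'I_N.+1 => r (phi (h i))).
  by apply/negP => /injectiveP /leq_card; rewrite card_ord ltnn.
have [i [j ne /rP [Z eZ]]] := elimT (injectivePn _) ninj.
exists ((h i)^-1 * h j)%g, (- (phi (h i)^-1%g *m Z)).
have iV : phi (h i)^-1%g *m phi (h i) = 1%:M by rewrite -phiM mulVg.
rewrite phiM; split.
  have -> : phi (h j) = phi (h i) - Z *+ p by rewrite -eZ opprB addrC subrK.
  by rewrite mulmxBr iV mulNrn raddfMn.
move=> e; have := phi_inj _ _ ne.
by rewrite -[phi (h j)]mul1mx -phi1 -(mulgV (h i)) phiM -mulmxA e mulmx1 eqxx.
Qed.

(** * Index estimates by finite types *)

Section Index.
Variable G : groupType.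
Implicit Types H : set G.

Lemma left_coset_eqP H (g h : G) : subgroup H ->
  left_coset g H = left_coset h H <-> H (g^-1 * h)%g.
Proof.
move=> [H1 HM HV]; split => [e|gh].
  have : left_coset h H h by exists 1%g => //; rewrite mulg1.
  by rewrite -e => -[x Hx <-]; rewrite mulKg.
apply/seteqP; split => _ [x Hx <-].
  exists ((g^-1 * h)^-1 * x)%g; first by apply: HM => //; exact: HV.
  by rewrite invgM invgK !mulgA mulgV mul1g.
by exists (g^-1 * h * x)%g; [exact: HM|rewrite !mulgA mulgV mul1g].
Qed.

(** The coset of [g] depends only on [f g], so [F] enumerates all cosets, possibly with junk values
    off the image of [f]. *)
Lemma index_le_card H (F : finType) (f : G -> F) : subgroup H ->
  (forall g h, f g = f h -> H (g^-1 * h)%g) ->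
  finite_index H /\ (subgroup_index H <= #|F|)%N.
Proof.
move=> sH fH.
have [c cP] : exists c : F -> set G, forall g, c (f g) = left_coset g H.
  have [c cP] : {c : F -> set G & forall y, forall g, f g = y -> c y = left_coset g H}.
    apply: (@choice _ _ (fun y X => forall g, f g = y -> X = left_coset g H)) => y.
    have [[g gy]|ne] := pselect (exists g, f g = y).
      exists (left_coset g H) => h hy.
      by apply/left_coset_eqP => //; apply: fH; rewrite gy.
    by exists set0 => g gy; case: ne; exists g.
  by exists c => g; exact: cP.
pose s := [seq c y | y <- enum F].
have sub : (left_cosets H `<=` [set` s])%classic.
  move=> _ [g _ <-] /=; rewrite -cP; apply: map_f; exact: mem_enum.
have fin : finite_index H by apply: sub_finite_set sub _; exact: finite_seq.
split => //; rewrite /subgroup_index cardE -(size_map c) -/s.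
apply: uniq_leq_size; first exact: fset_uniq.
by move=> X; rewrite in_fset_set // => /set_mem /sub.
Qed.

Lemma card_le_index H (F : finType) (f : F -> G) : subgroup H -> finite_index H ->
  (forall i j, H ((f i)^-1 * f j)%g -> i = j) -> (#|F| <= subgroup_index H)%N.
Proof.
move=> sH fin fH; rewrite /subgroup_index cardE -(size_map (fun i => left_coset (f i) H)).
apply: uniq_leq_size.
  rewrite map_inj_uniq ?enum_uniq // => i j /left_coset_eqP.
  by move=> /(_ sH) /fH.
by move=> _ /mapP [i _ ->]; rewrite in_fset_set //; apply: mem_set; exists (f i).
Qed.

(** Numbering the cosets by an ordinal turns index inequalities into injections between finite
    types. *)
Lemma coset_representatives H : subgroup H -> finite_index H ->
  exists (c : G -> 'I_(subgroup_index H)) (s : 'I_(subgroup_index H) -> G),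
    (forall g h, c g = c h <-> H (g^-1 * h)%g) /\ cancel s c.
Proof.
move=> sH fin; set S := fset_set (left_cosets H).
have SP g : left_coset g H \in S by rewrite in_fset_set //; apply: mem_set; exists g.
pose c g := Ordinal (etrans (index_mem (left_coset g H) S) (SP g)).
have [s sP] : {s : 'I_(subgroup_index H) -> G &
    forall i, left_coset (s i) H = nth set0 S i}.
  apply: (@choice _ _ (fun (i : 'I_(subgroup_index H)) g =>
    left_coset g H = nth set0 S i)) => i.
  have : nth set0 S i \in S by apply: mem_nth.
  by rewrite in_fset_set // => /set_mem [g _ <-]; exists g.
exists c, s; split.
  move=> g h; rewrite -left_coset_eqP //; split => [/(congr1 val) /= e|e].
    by rewrite -(nth_index set0 (SP g)) e nth_index.
  by apply/val_inj; rewrite /= e.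
by move=> i; apply/val_inj; rewrite /= sP index_uniq //; exact: fset_uniq.
Qed.

End Index.

(** * Filtrations by congruence subgroups *)

(** What the index estimates retain of a congruence representation. Powers are controlled from level
    1 on only, level 0 being the whole group. *)
Record congruence_filtration (p : nat) (G : groupType) (D : nat -> nfi G) : Prop :=
  CongruenceFiltration {
    filtration0 : forall g, nfi_set (D 0%N) g;
    filtrationS : forall k, (D k.+1 `<=` D k)%classic;
    filtration_index : exists C, forall k,
      (subgroup_index (D k.+1) <= C * subgroup_index (D k))%N;
    filtration_power : forall k g, nfi_set (D k.+1) g -> nfi_set (D k.+2) (g ^+ p)%g;
    filtration_proper : exists k0, forall k, (k0 <= k)%N ->
      exists g, nfi_set (D k) g /\ ~ nfi_set (D k.+1) g
  }.

Lemma expr1D_expansion (R : pzRingType) (x : R) n : (1 < n)%N ->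
  exists y, (1 + x) ^+ n = 1 + x *+ n + x ^+ 2 *+ 'C(n, 2) + x ^+ 3 * y.
Proof.
case: n => [//|[//|n]] _; exists (\sum_(i < n) x ^+ i *+ 'C(n.+2, i.+3)).
rewrite addrC exprD1n 3!big_ord_recl /= bin0 bin1 mulr1n expr0 expr1 !addrA.
congr (_ + _); rewrite mulr_sumr; apply: eq_bigr => i _.
by rewrite mulrnAr -exprD.
Qed.

(** The quadratic term gains a factor [p] from the binomial coefficient, as [p] is odd, and the rest
    carries [p ^ (3 * k.+1)]; both are multiples of [p ^ k.+3]. *)
Lemma expr1D_prime (R : pzRingType) p k (Z : R) : prime p -> odd p ->
  exists W, (1 + Z *+ p ^ k.+1) ^+ p = 1 + Z *+ p ^ k.+2 + W *+ p ^ k.+3.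
Proof.
move=> pp op; have p1 := prime_gt1 pp; have p2 : (2 < p)%N.
  by case: p pp op p1 => [|[|[|]]].
have [y ->] := expr1D_expansion (Z *+ p ^ k.+1) p1.
have /dvdnP [c ->] : (p %| 'C(p, 2))%N by apply: prime_dvd_bin.
exists (Z ^+ 2 *+ (c * p ^ k) + Z ^+ 3 * y *+ p ^ (k + k)).
rewrite mulrnDl -!mulrnA -expnSr !addrA; congr (_ + _ + _); rewrite exprMn_n.
  by rewrite -mulrnA; congr (_ *+ _); rewrite !expnS expn0 muln1; ring.
rewrite mulrnAl; congr (_ *+ _); rewrite -expnM -expnD; congr (_ ^ _)%N; lia.
Qed.

Section CongruenceFiltration.
Variables (p : nat) (G : groupType) (m : nat) (E : comNzRingType) (T : finType).
Variable phi : G -> 'M[E]_m.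
Hypotheses (pp : prime p) (op : odd p) (pE : padic p T E).
Hypotheses (phi1 : phi 1%g = 1) (phiM : forall g h, phi (g * h)%g = phi g * phi h).

Definition congruence_set k : set G :=
  [set g | exists Z, phi g = 1 + Z *+ p ^ k]%classic.

Let phiV g : phi g^-1%g * phi g = 1.
Proof. by rewrite -phiM mulVg. Qed.

Let phiX g n : phi (g ^+ n)%g = phi g ^+ n.
Proof.
by elim: n => [|n IH]; rewrite ?expg0 ?expr0 // expgS exprS phiM IH.
Qed.

Lemma matrix_torsion_free k (X : 'M[E]_m) : X *+ p ^ k = 0 -> X = 0.
Proof.
move=> X0; apply/matrixP => i j; rewrite mxE.
by apply: (padic_torsion_freeX (N := k) pE); rewrite -mulmxnE X0 mxE.
Qed.

Lemma congruence_normal k : normal_subgroup (congruence_set k).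
Proof.
split; first split.
- by exists 0; rewrite mul0rn addr0.
- move=> g h [X eX] [Y eY]; exists (X + Y + (X * Y) *+ p ^ k).
  rewrite phiM eX eY mulrDr mulr1 mulrDl mul1r mulrnAl mulrnAr.
  by rewrite !mulrnDl !addrA.
- move=> g [X eX]; exists (- (phi g^-1%g * X)).
  by have := phiV g; rewrite {1}eX mulrDr mulr1 mulrnAr => <-; rewrite mulNrn addrK.
- move=> g h [X eX]; exists (phi g^-1%g * X * phi g).
  by rewrite conjgE !phiM eX mulrA mulrDr mulr1 mulrDl phiV mulrnAr mulrnAl.
Qed.

Lemma congruence_setS k : (congruence_set k.+1 `<=` congruence_set k)%classic.
Proof. by move=> g [X eX]; exists (X *+ p); rewrite eX -mulrnA -expnS. Qed.

Lemma congruence_set0 g : congruence_set 0 g.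
Proof. by exists (phi g - 1); rewrite expn0 mulr1n addrC subrK. Qed.

(** If [u] represents the level [k] coset of [g] and [u^-1 * g] maps to [1 + Z *+ p ^ k], then this
    coset and the residue of [Z] modulo [p] determine the coset of [g] at level [k.+1]. *)
Lemma congruence_index_step k : finite_index (congruence_set k) ->
  finite_index (congruence_set k.+1) /\
  (subgroup_index (congruence_set k.+1) <=
    #|{ffun 'I_m * 'I_m -> T}| * subgroup_index (congruence_set k))%N.
Proof.
move=> fin; have [sk _] := congruence_normal k.
have [c [s [cP sK]]] := coset_representatives sk fin.
have [r rP] := matrix_residue m m pE.
have /choice [Z ZP] g : exists Z, phi ((s (c g))^-1 * g)%g = 1 + Z *+ p ^ k.
  by have /cP : c (s (c g)) = c g by rewrite sK.
pose F := ({ffun 'I_m * 'I_m -> T} * 'I_(subgroup_index (congruence_set k)))%type.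
pose f g : F := (r (Z g), c g).
have [|fin' le] := index_le_card (f := f) (congruence_normal k.+1).1.
  move=> g h [/rP [W eW] ec].
  set u := s (c g) in ZP *.
  have -> : (g^-1 * h = (u^-1 * g)^-1 * (u^-1 * h))%g.
    by rewrite invgM invgK -!mulgA mulVKg.
  exists (- (phi ((u^-1 * g)^-1)%g * W)).
  have eh : phi (u^-1 * h)%g = phi (u^-1 * g)%g - W *+ p ^ k.+1.
    rewrite (ZP g) [in LHS]/u ec (ZP h) expnS mulrnA -eW mulrnBl.
    by rewrite opprB addrA [1 + _ + _]addrAC addrK.
  by rewrite phiM eh mulrBr phiV mulrnAr mulNrn.
by split=> //; rewrite card_prod card_ord in le.
Qed.

Lemma congruence_finite k : finite_index (congruence_set k).
Proof.
elim: k => [|k IH]; last by have [] := congruence_index_step IH.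
have [|//] := index_le_card (F := unit) (f := fun _ => tt) (congruence_normal 0).1.
by move=> *; exact: congruence_set0.
Qed.

Definition congruence_nfi k : nfi G := NFI (congruence_normal k) (congruence_finite k).

Lemma congruence_power k g : congruence_set k.+1 g ->
  congruence_set k.+2 (g ^+ p)%g.
Proof.
move=> [X eX]; rewrite /congruence_set /= phiX eX.
have [W ->] := expr1D_prime k X pp op.
by exists (X + W *+ p); rewrite mulrnDl -mulrnA -expnS addrA.
Qed.

(** In the expansion of the [p]-th power, torsion-freeness cancels [p ^ k.+2], leaving [X] divisible
    by [p] if the conclusion failed. *)
Lemma congruence_power_proper k g : congruence_set k.+1 g ->
  ~ congruence_set k.+2 g -> ~ congruence_set k.+3 (g ^+ p)%g.
Proof.
move=> [X eX] gk; rewrite /congruence_set /= phiX eX.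
have [W ->] := expr1D_prime k X pp op.
move=> [V]; rewrite -addrA => /addrI e; apply: gk; exists (V - W).
have {}e : (X - (V - W) *+ p) *+ p ^ k.+2 = 0.
  by rewrite mulrnBl -mulrnA -expnS mulrnBl -e addrK subrr.
move/(@matrix_torsion_free k.+2): e => /eqP; rewrite subr_eq0 => /eqP eX'.
by rewrite eX eX' -mulrnA -expnS.
Qed.

(** By separatedness [g] lies in a last level [k.+1], taken as [k0]; from there each [p]-th power
    moves exactly one level deeper. *)
Lemma congruence_proper g : congruence_set 1 g -> phi g <> 1 ->
  exists k0, forall k, (k0 <= k)%N ->
    exists h, congruence_set k h /\ ~ congruence_set k.+1 h.
Proof.
move=> g1 gn.
have exk : exists k, `[< ~ congruence_set k g >].
  apply: contrapT => H; apply: gn; apply/eqP; rewrite -subr_eq0; apply/eqP/matrixP => i j.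
  rewrite [RHS]mxE; apply: (padic_separated pE) => k.
  have : congruence_set k g.
    by apply: contrapT => H'; apply: H; exists k; apply/asboolP.
  by move=> [Z ->]; exists (Z i j); rewrite addrC addKr mulmxnE.
case: (ex_minnP exk) => -[|[|k]] /asboolP gk kmin.
- by case: gk; exact: congruence_set0.
- by [].
exists k.+1 => l /subnKC <-; elim: (l - k.+1)%N => [|n [h [hk hk']]].
  exists g; rewrite addn0; split=> //.
  apply: contrapT => H; have := kmin k.+1; rewrite ltnn => /(_ _)/negP; apply => //.
  by apply/asboolP.
rewrite addnS; exists (h ^+ p)%g; rewrite addSn in hk hk' *; split.
  exact: congruence_power.
exact: congruence_power_proper.
Qed.

End CongruenceFiltration.

Lemma congruence_rep_filtration p (G : groupType) : prime p -> odd p ->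
  congruence_rep p G -> exists D, @congruence_filtration p G D.
Proof.
move=> pp op [m [E [T [phi [pE phi1 phiM [g [Z [eg gn]]]]]]]].
exists (congruence_nfi pE phi1 phiM); split.
- exact: congruence_set0.
- exact: congruence_setS.
- exists #|{ffun 'I_m * 'I_m -> T}| => k.
  by have [] := congruence_index_step pE phi1 phiM (congruence_finite pE phi1 phiM k).
- by move=> k h; exact: congruence_power.
- by apply: (congruence_proper pp op pE phi1 phiM (g := g)) => //; exists Z.
Qed.

(** * Index of the intersection of two filtrations *)

Section IntersectionIndex.
Variable G : groupType.
Implicit Types N M H : nfi G.

Lemma nfi_representatives N :
  exists (c : G -> 'I_(subgroup_index N)) (s : 'I_(subgroup_index N) -> G),
    (forall g h, c g = c h <-> nfi_set N (g^-1 * h)%g) /\ cancel s c.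
Proof. exact: coset_representatives (nfi_normal N).1 (nfi_finite N). Qed.

Lemma nfiI_normal N M : normal_subgroup (N `&` M)%classic.
Proof.
split; first split.
- by split; exact: nfi1.
- by move=> x y [? ?] [? ?]; split; exact: nfiM.
- by move=> x [? ?]; split; exact: nfiV.
- by move=> g h [? ?]; split; exact: nfiJ.
Qed.

Lemma nfiI_finite N M : finite_index (N `&` M)%classic.
Proof.
have [c [_ [cP _]]] := nfi_representatives N.
have [d [_ [dP _]]] := nfi_representatives M.
have [|//] := index_le_card (f := fun g => (c g, d g)) (nfiI_normal N M).1.
by move=> g h [/cP ? /dP ?].
Qed.

Definition nfiI N M : nfi G := NFI (nfiI_normal N M) (nfiI_finite N M).

Lemma nfi_index_gt0 N : (0 < subgroup_index N)%N.
Proof.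
have [c _] := nfi_representatives N.
by case: (c 1%g) => i; exact: leq_ltn_trans.
Qed.

(** For [a] in [N] but not in [M], the elements [s i] and [s i * a] all lie in distinct cosets of
    [M]. *)
Lemma nfi_index_double N M : (M `<=` N)%classic ->
  (exists g, nfi_set N g /\ ~ nfi_set M g) ->
  (2 * subgroup_index N <= subgroup_index M)%N.
Proof.
move=> MN [a [Na Ma]].
have [c [s [cP sK]]] := nfi_representatives N.
pose f (bi : bool * 'I_(subgroup_index N)) := (s bi.2 * (if bi.1 then a else 1))%g.
have := card_le_index (f := f) (nfi_normal M).1 (nfi_finite M).
rewrite card_prod card_bool card_ord; apply => -[b i] [b' j]; rewrite /f /= => Mij.
pose t (b : bool) := if b then a else 1%g.
have Nt b0 : nfi_set N (t b0) by case: b0 => //; exact: nfi1.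
have ij : i = j.
  rewrite -(sK i) -(sK j); apply/cP.
  have -> : ((s i)^-1 * s j = t b * ((s i * t b)^-1 * (s j * t b')) * (t b')^-1)%g.
    by rewrite invgM !mulgA mulgK mulgV mul1g.
  by apply: nfiM; [apply: nfiM => //; exact: MN|exact: nfiV].
move: Mij; rewrite ij invgM -mulgA mulKg.
case: b b' => [] [] //=; rewrite ?invg1 ?mulg1 ?mul1g => H.
  by case: Ma; rewrite -[a]invgK; exact: nfiV.
by case: Ma.
Qed.

Variables (p q : nat) (D D' : nat -> nfi G).
Hypotheses (pp : prime p) (pq : prime q) (npq : p != q).
Hypotheses (fD : congruence_filtration p D) (fD' : congruence_filtration q D').

Lemma filtration_expX (r : nat) (F : nat -> nfi G) k g : congruence_filtration r F ->
  nfi_set (F 1%N) g -> nfi_set (F k) (g ^+ (r ^ k))%g.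
Proof.
(* The induction proves membership at level [k.+1], where the case [k = 0] is the hypothesis. *)
move=> fF g1; apply: (filtrationS fF).
elim: k => [|k IH]; first by rewrite expn0 expg1.
by rewrite expnSr expgnA; exact: (filtration_power fF).
Qed.

Lemma nfi_expg N g n : nfi_set N g -> nfi_set N (g ^+ n)%g.
Proof.
move=> Ng; elim: n => [|n IH]; first by rewrite expg0; exact: nfi1.
by rewrite expgS; exact: nfiM.
Qed.

(* With m p^k = 1 + n q^k, the element c = a^(-n q^k) b^(m p^k) works, because
   p^k-th powers from D 1 lie in D k and q^k-th powers from D' 1 lie in D' k. *)
Lemma filtration_glue k a b : nfi_set (nfiI (D 1%N) (D' 1%N)) a ->
  nfi_set (nfiI (D 1%N) (D' 1%N)) b ->
  exists c, nfi_set (D k) (a^-1 * c)%g /\ nfi_set (D' k) (b^-1 * c)%g.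
Proof.
move=> [a1 a1'] [b1 b1'].
have cpq : coprime (p ^ k) (q ^ k).
  by rewrite coprimeXl // coprimeXr // prime_coprime // dvdn_prime2.
have [|n _] := @Bezoutl (p ^ k) (q ^ k); first by rewrite expn_gt0 prime_gt0.
rewrite (eqP cpq) => /dvdnP [m e].
exists ((a ^+ (n * q ^ k))^-1 * b ^+ (m * p ^ k))%g; split.
  rewrite mulgA -invgM -expgSr -add1n e; apply: nfiM.
    by apply: nfiV; rewrite mulnC expgnA; apply: nfi_expg; exact: filtration_expX.
  by rewrite mulnC expgnA; apply: nfi_expg; exact: filtration_expX.
rewrite -e add1n expgS !mulgA -[(b^-1 * _ * b)%g]mulgA -conjgE.
apply: nfiM; [apply: nfiJ; apply: nfiV|];
  by rewrite mulnC expgnA; apply: nfi_expg; exact: filtration_expX.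
Qed.

(** Representatives moved into [Lam] can be glued. A pair of cosets is recovered from the two
    [Lam]-cosets of its representatives and the coset of the glued element, whence the square of the
    index of [Lam]. *)
Lemma filtration_index_mul : exists L, forall k,
  (subgroup_index (D k) * subgroup_index (D' k)
    <= L * subgroup_index (nfiI (D k) (D' k)))%N.
Proof.
set Lam := nfiI (D 1%N) (D' 1%N).
exists (subgroup_index Lam * subgroup_index Lam)%N => k.
have [c [s [cP sK]]] := nfi_representatives (D k).
have [d [t [dP tK]]] := nfi_representatives (D' k).
have [e [u [eP uK]]] := nfi_representatives Lam.
have [n [_ [nP _]]] := nfi_representatives (nfiI (D k) (D' k)).
pose red g := ((u (e g))^-1 * g)%g.
have redP g : nfi_set Lam (red g) by apply/eP; rewrite uK.
have /choice [z zP] (ij : 'I_(subgroup_index (D k)) * 'I_(subgroup_index (D' k))) :=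
  filtration_glue k (redP (s ij.1)) (redP (t ij.2)).
pose f ij := (e (s ij.1), e (t ij.2), n (z ij)).
have finj : injective f.
  move=> [i j] [i' j'] [e1 e2 /nP [zz zz']].
  have [zi zj] := zP (i, j); have [zi' zj'] := zP (i', j').
  rewrite /= in zi zj zi' zj' zz zz'.
  congr (_, _).
    rewrite -(sK i) -(sK i'); apply/cP.
    have -> : ((s i)^-1 * s i' = (red (s i))^-1 * z (i, j) *
        ((z (i, j))^-1 * z (i', j')) * ((red (s i'))^-1 * z (i', j'))^-1)%g.
      by rewrite /red e1 !invgM !invgK !mulgA !mulgK.
    by apply: nfiM; [exact: nfiM|exact: nfiV].
  rewrite -(tK j) -(tK j'); apply/dP.
  have -> : ((t j)^-1 * t j' = (red (t j))^-1 * z (i, j) *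
      ((z (i, j))^-1 * z (i', j')) * ((red (t j'))^-1 * z (i', j'))^-1)%g.
    by rewrite /red e2 !invgM !invgK !mulgA !mulgK.
  by apply: nfiM; [exact: nfiM|exact: nfiV].
by have := leq_card f finj; rewrite !card_prod !card_ord.
Qed.

(** The index doubles at each step from [k0] on; the factor [2 ^ k0] absorbs the earlier levels. *)
Lemma filtration_growth (r : nat) (F : nat -> nfi G) : congruence_filtration r F ->
  exists A, forall k, (2 ^ k <= A * subgroup_index (F k))%N.
Proof.
move=> fF; have [k0 k0P] := filtration_proper fF; exists (2 ^ k0)%N => k.
have [kk0|/subnKC <-] := leqP k k0.
  by apply: leq_trans (leq_pmulr _ (nfi_index_gt0 _)); rewrite leq_exp2l.
rewrite addSn -addnS; elim: (k - k0.+1).+1 => [|n IH].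
  by rewrite addn0 leq_pmulr // nfi_index_gt0.
rewrite addnS expnS.
apply: leq_trans (_ : 2 * (2 ^ k0 * subgroup_index (F (k0 + n))) <= _)%N.
  by rewrite leq_mul2l IH.
rewrite mulnCA leq_mul2l; apply/orP; right; apply: nfi_index_double.
  exact: (filtrationS fF).
by apply: k0P; exact: leq_addr.
Qed.

(** In each summand the next index is bounded by the current one of the same filtration, and [2 ^ k]
    by the index of the other; their product is then compared with the intersection. *)
Lemma two_filtrations : exists B, forall k,
  ((subgroup_index (D k.+1) + subgroup_index (D' k.+1)) * 2 ^ k
    <= B * subgroup_index (nfiI (D k) (D' k)))%N.
Proof.
have [L LP] := filtration_index_mul.
have [C CP] := filtration_index fD; have [C' CP'] := filtration_index fD'.
have [A AP] := filtration_growth fD; have [A' AP'] := filtration_growth fD'.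
exists ((C * A' + C' * A) * L)%N => k.
have := CP k; have := CP' k; have := AP k; have := AP' k; have := LP k.
move: (subgroup_index (D k)) (subgroup_index (D' k)) (subgroup_index (nfiI _ _)).
move=> i j n ij aj ai cj ci.
rewrite mulnDl -mulnA; apply: leq_trans (leq_mul (leqnn (C * A' + C' * A)) ij).
rewrite mulnDl; apply: leq_add.
  by apply: leq_trans (leq_mul ci aj) _; apply: eq_leq; ring.
by apply: leq_trans (leq_mul cj ai) _; apply: eq_leq; ring.
Qed.

End IntersectionIndex.

(** * Haar measure and divisibility on the completion *)

Section HaarMeasure.
Local Open Scope classical_set_scope.
Variables (R : realType) (G : groupType) (mu : probability (borel_profinite G) R).
Hypothesis mu_haar : is_haar mu.
Implicit Types N M : nfi G.

(** The closure of the coset of [g], described by a projection so that it is visibly a subbasic open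
    set. *)
Definition profinite_coset (N : nfi G) (g : G) : set (borel_profinite G) :=
  [set x : profinite G | pf_proj x N = left_coset g N].

Lemma open_profinite_coset N g : open (profinite_coset N g : set (profinite G)).
Proof.
exists [set profinite_coset N g : set (profinite G)]; last by rewrite bigcup_set1.
move=> _ ->; exists [fset (profinite_coset N g : set (profinite G))]%fset.
  move=> A; rewrite in_fset1 => /eqP ->; apply: mem_set.
  by exists N, (left_coset g N).
by rewrite set_fset1 bigcap_set1.
Qed.

Lemma measurable_profinite_coset N g : measurable (profinite_coset N g).
Proof. by apply: sub_sigma_algebra; exact: open_profinite_coset. Qed.

Lemma haar_profinite_coset N g : mu (profinite_coset N g) = mu (profinite_coset N 1%g).
Proof.
rewrite -(mu_haar (pf_embed g) (measurable_profinite_coset N 1%g)); congr (mu _).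
apply/seteqP; split => [x xN|_ [x xN <-]].
  exists (pf_embed g^-1 * x)%g.
    rewrite /profinite_coset /=.
    have -> : pf_proj x N = left_coset g N := xN.
    by rewrite left_coset_mul mulVg.
  apply: pf_ext => M /=.
  have [h _ <-] := pf_coset x M.
  by rewrite !left_coset_mul mulVKg.
rewrite /profinite_coset /=.
have -> : pf_proj x N = left_coset 1%g N := xN.
by rewrite left_coset_mul mulg1.
Qed.

(** The translates by coset representatives are disjoint, have equal measure and fit into total mass
    1. *)
Lemma haar_open_subgroup N :
  ((subgroup_index N)%:R%:E * mu (profinite_coset N 1%g) <= 1)%E.
Proof.
have [c [s [cP sK]]] := nfi_representatives N.
rewrite -(probability_setT mu).
have tr : trivIset setT (fun i : 'I_(subgroup_index N) => profinite_coset N (s i)).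
  move=> i j _ _ [x [xi xj]].
  rewrite -(sK i) -(sK j); apply/cP; apply/left_coset_eqP; first exact: (nfi_normal N).1.
  by rewrite -xi.
have := measure_bigsetU_ord mu xpredT (fun i => measurable_profinite_coset N (s i)) tr.
rewrite (eq_bigr (fun=> mu (profinite_coset N 1%g))); last first.
  by move=> i _; exact: haar_profinite_coset.
rewrite sumr_const card_ord => e.
have -> : ((subgroup_index N)%:R%:E * mu (profinite_coset N 1%g)
    = GRing.natmul (mu (profinite_coset N 1%g)) (subgroup_index N))%E.
  by rewrite mule_natl.
rewrite -e.
apply: le_measure => //; apply: mem_set; last exact: measurableT.
by apply: bigsetU_measurable => i _; exact: measurable_profinite_coset.
Qed.

(** If [x] were in the closure of [N], its open coset modulo [N] would meet the image of [N], hence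
    be [N] itself. *)
Lemma normal_divisibility_le N (x : profinite G) : ~ profinite_coset N 1%g x ->
  (normal_divisibility x <= (subgroup_index N)%:R%:E :> \bar R)%E.
Proof.
move=> xN; apply: ereal_inf_lbound; exists N => //= /(_ (profinite_coset N _)).
have [g _ gN] := pf_coset x N.
move=> /(_ g); have nb : nbhs x (profinite_coset N g).
  by apply: open_nbhs_nbhs; split; [exact: open_profinite_coset|].
move=> /(_ nb) [_ [[h Nh <-] hg]]; apply: xN.
rewrite /profinite_coset /= -gN -hg /=.
by apply/left_coset_eqP; [exact: (nfi_normal N).1|rewrite mulg1; exact: nfiV].
Qed.

(** The set where the divisibility is below [r] is a union of complements of closures, hence
    open. *)
Lemma measurable_normal_divisibility :
  measurable_fun [set: borel_profinite G]
    (fun x : borel_profinite G => @normal_divisibility R G x).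
Proof.
apply: (measurability _ (ErealGenInftyO.measurableE R)) => // _ [_ [r ->] <-].
rewrite setTI; apply: sub_sigma_algebra.
rewrite (_ : _ @^-1` _ =
    \bigcup_(N in [set N : nfi G | (subgroup_index N)%:R < r]) ~` (nfi_closure N)).
  by apply: bigcup_open => N _; apply: closed_openC; exact: closed_closure.
apply/seteqP; split => x /=; rewrite in_itv /=.
  by move=> /ereal_inf_lt [_ [N /= xN <-]]; rewrite lte_fin => Nr; exists N.
move=> [N /= Nr xN]; apply: le_lt_trans (_ : _ <= (subgroup_index N)%:R%:E)%E _.
  by apply: ereal_inf_lbound; exists N.
by rewrite lte_fin.
Qed.

End HaarMeasure.

(** * Bounding the average by a geometric series *)

Section Average.
Local Open Scope classical_set_scope.
Local Open Scope ereal_scope.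
Variables (R : realType) (G : groupType) (mu : probability (borel_profinite G) R).
Hypothesis mu_haar : is_haar mu.

Lemma measure_le_inv_index (N : nfi G) (a b k : nat) :
  (a * 2 ^ k <= b * subgroup_index N)%N ->
  a%:R%:E * mu (profinite_coset N 1%g) <= (b%:R / (2 ^ k)%:R)%:E.
Proof.
move=> ab; have := haar_open_subgroup mu_haar N.
have muf : mu (profinite_coset N 1%g) \is a fin_num.
  by apply: fin_num_measure; exact: measurable_profinite_coset.
rewrite -(fineK muf) -!EFinM !lee_fin.
have m0 : (0 <= fine (mu (profinite_coset N 1%g)))%R.
  by apply: fine_ge0; exact: measure_ge0.
set m := fine _ in m0 *; move=> nm.
rewrite ler_pdivlMr ?ltr0n ?expn_gt0 // mulrAC -natrM.
apply: le_trans (_ : (b * subgroup_index N)%:R * m <= _)%R.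
  by apply: ler_wpM2r => //; rewrite ler_nat.
by rewrite natrM -mulrA ler_piMr // ler0n.
Qed.

(** The divisibility is dominated pointwise by the series of [a k] times the indicator of the
    closure of [N k]; integrating termwise gives at most the sum of [b / 2 ^ k]. *)
Lemma normal_residual_average_lty (N : nat -> nfi G) (a : nat -> nat) (b : nat) :
  (forall g, nfi_set (N 0%N) g) ->
  (forall k, (0 < a k)%N /\ (a k * 2 ^ k <= b * subgroup_index (N k))%N) ->
  (forall k (x : profinite G), ~ profinite_coset (N k.+1) 1%g x ->
    normal_divisibility x <= (a k)%:R%:E :> \bar R) ->
  normal_residual_average mu < +oo.
Proof.
move=> N0 aP aD.
pose f k (x : borel_profinite G) : \bar R :=
  (a k)%:R%:E * (\1_(profinite_coset (N k) 1%g) x)%:E.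
have f0 k x : 0 <= f k x by rewrite mule_ge0 // lee_fin.
have mf k : measurable_fun [set: borel_profinite G] (f k).
  apply: measurable_funeM; apply/measurable_EFinP.
  by apply: measurable_indic; exact: measurable_profinite_coset.
have Df x : normal_divisibility x <= \sum_(k <oo) f k x.
  have [exk|H] := pselect (exists k, ~ profinite_coset (N k) 1%g x).
    have exk' : exists k, `[< ~ profinite_coset (N k) 1%g x >].
      by have [k kx] := exk; exists k; apply/asboolP.
    (* The first level missing [x] is a successor because [N 0] is everything; term [k] of the
       series then suffices. *)
    case: (ex_minnP exk') => -[|k] /asboolP kx kmin.
      case: kx; rewrite /profinite_coset /=; have [g _ <-] := pf_coset x (N 0%N).
      by apply/left_coset_eqP; [exact: (nfi_normal _).1|exact: N0].
    have kx' : profinite_coset (N k) 1%g x.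
      apply: contrapT => kx'; have := kmin k; rewrite ltnn => /(_ _)/negP; apply => //.
      by apply/asboolP.
    apply: le_trans (nneseries_lim_ge k.+1 _) => //.
    rewrite big_nat_recr //= /f indicE mem_set // mule1.
    apply: le_trans (aD _ _ kx) _; apply: leeDr.
    by apply: sume_ge0 => j _; exact: f0.
  have xk k : profinite_coset (N k) 1%g x by apply: contrapT => ?; apply: H; exists k.
  (* A point in all the closures has every term at least 1, since each [a k] is positive. *)
  suff -> : \sum_(k <oo) f k x = +oo by exact: leey.
  apply: eq_infty => t.
  apply: le_trans (nneseries_lim_ge (Num.truncn `|t|).+1 _) => //.
  apply: (@le_trans _ _ (\sum_(0 <= k < (Num.truncn `|t|).+1) 1)).
    rewrite big_mkord sumEFin sumr_const card_ord lee_fin.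
    apply: le_trans (ler_norm t) _; apply: ltW; exact: truncnS_gt.
  apply: lee_sum => k _; rewrite /f indicE mem_set // mule1 lee_fin ler1n.
  by case: (aP k).
have D0 x : 0 <= normal_divisibility x :> \bar R.
  by apply: le_ereal_inf_tmp => _ [M _ <-]; rewrite lee_fin.
apply: le_lt_trans
  (_ : \int[mu]_(x in [set: borel_profinite G]) (\sum_(k <oo) f k x) < _).
  apply: ge0_le_integral => //.
  - exact: measurable_normal_divisibility.
  - by apply: ge0_emeasurable_sum.
rewrite integral_nneseries //.
(* Writing [b / 2 ^ k] as [2 * b / 2 ^ k.+1] matches the geometric series of [epsilon_trick0]. *)
apply: le_lt_trans (_ : \sum_(k <oo) ((2 * b)%:R / (2 ^ k.+1)%:R)%:E < _).
  apply: lee_nneseries => [k _ _|k _]; first exact: integral_ge0.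
  rewrite ge0_integralZl_EFin //; last first.
    apply/measurable_EFinP; apply: measurable_indic; exact: measurable_profinite_coset.
  rewrite integral_indic ?setIT //; last exact: measurable_profinite_coset.
  apply: le_trans (measure_le_inv_index (aP k).2) _.
  by rewrite lee_fin expnS !natrM invfM mulrACA divff ?mul1r.
apply: le_lt_trans (epsilon_trick0 xpredT _) _ => //.
exact: ltry.
Qed.

End Average.

(** Compatibility of the projections puts any representative of [x] modulo the intersection in both
    [N] and [M]. *)
Lemma profinite_cosetI (G : groupType) (N M : nfi G) (x : profinite G) :
  profinite_coset N 1%g x -> profinite_coset M 1%g x ->
  profinite_coset (nfiI N M) 1%g x.
Proof.
rewrite /profinite_coset /= => xN xM.
have [g _ gx] := pf_coset x (nfiI N M).
have xg : pf_proj x (nfiI N M) g by rewrite -gx; exists 1%g; [exact: nfi1|rewrite mulg1].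
have subN : (nfiI N M `<=` N)%classic by move=> h [].
have subM : (nfiI N M `<=` M)%classic by move=> h [].
have := pf_compat subN xg; rewrite xN => -[h Nh]; rewrite mul1g => eh.
have := pf_compat subM xg; rewrite xM => -[h' Mh']; rewrite mul1g => eh'.
rewrite -gx; apply/left_coset_eqP; first exact: (nfi_normal _).1.
by rewrite mulg1; apply: nfiV; split; [rewrite -eh|rewrite -eh'].
Qed.

Theorem theorem1p4 (R : realType) (G : groupType)
    (G_infinite : infinite_set [set: G]%classic)
    (G_fg : finitely_generated G)
    (G_linear : linear_group R[i] G)
    (mu : probability (borel_profinite G) R)
    (mu_haar : is_haar mu) :
  (normal_residual_average mu < +oo)%E.
Proof.
have ch n : n.+1%:R != 0 :> R[i] by rewrite pnatr_eq0.
have [P0 HP] := linear_congruence_rep ch G_infinite G_fg G_linear.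
have filt p : prime p -> (maxn P0 2 < p)%N -> exists D, @congruence_filtration p G D.
  rewrite gtn_max => pp /andP [Pp p2].
  apply: congruence_rep_filtration (HP p pp Pp) => //.
  by case: (even_prime pp) => // p2'; rewrite p2' in p2.
have [p Pp pp] := prime_above (maxn P0 2).
have [q pq qp] := prime_above p.
have [D fD] := filt p pp Pp.
have [D' fD'] := filt q qp (ltn_trans Pp pq).
have npq : p != q by rewrite neq_ltn pq.
have [B HB] := two_filtrations pp qp npq fD fD'.
apply: (normal_residual_average_lty mu_haar (N := fun k => nfiI (D k) (D' k))
  (a := fun k => (subgroup_index (D k.+1) + subgroup_index (D' k.+1))%N) (b := B)).
- by move=> g; split; [exact: (filtration0 fD)|exact: (filtration0 fD')].
- by move=> k; rewrite addn_gt0 nfi_index_gt0; split => //; exact: HB.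
move=> k x xN; have [xD|xD] := pselect (profinite_coset (D k.+1) 1%g x).
  have xD' : ~ profinite_coset (D' k.+1) 1%g x.
    by move=> ?; apply: xN; exact: profinite_cosetI.
  by apply: le_trans (normal_divisibility_le R xD') _; rewrite lee_fin ler_nat leq_addl.
by apply: le_trans (normal_divisibility_le R xD) _; rewrite lee_fin ler_nat leq_addr.
Qed.
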